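(* Let $(\Omega,\mathcal{F},\mu)$ be a probability space, let $H$ be a Hilbert space, and let $\varphi:\Omega\to H$ be a nontrivial (i.e. not $\mu$-almost everywhere equal to $\mathbf{0}$) strongly measurable function. Then $\varphi$ is a Hilbert point in $L^p(\Omega;H)$ for some $1\le p\le\infty$ with $p\neq 2$ if and only if there are a constant $C>0$ and a measurable set $E\subseteq\Omega$ with $\mu(E)>0$ such that $$\|\varphi(\omega)\|_H=\begin{cases} C, & \omega\in E,\\ 0, & \omega\notin E.\end{cases}$$
   Context: For $1\le p\le\infty$, $L^p(\Omega;H)$ is the usual Lebesgue–Bochner space of (classes of) strongly measurable $H$-valued functions $f$ on $\Omega$, with norm $\|f\|_p=\big(\int_\Omega\|f(\omega)\|_H^p\,d\mu(\omega)\big)^{1/p}$ (essential supremum of $\|f(\omega)\|_H$ if $p=\infty$). As usual, functions are identified when they agree $\mu$-almost everywhere, and pointwise statements about them are understood $\mu$-almost everywhere. Write $\langle f,g\rangle=\int_\Omega\langle f(\omega),g(\omega)\rangle_H\,d\mu(\omega)$ whenever this makes sense. Definition (Hilbert point). A Hilbert point in $L^p(\Omega;H)$ is a nontrivial function $\varphi\in L^p(\Omega;H)$ such that, for every $f\in L^p(\Omega;H)$, $\langle f,\varphi\rangle=0$ implies $\|\varphi\|_p\le\|\varphi+f\|_p$. When $p<2$, the condition $\langle f,\varphi\rangle=0$ is by convention interpreted as: $f$ lies in the closure in $L^p(\Omega;H)$ of the set $\{g\in L^\infty(\Omega;H):\langle g,\varphi\rangle=0\}$. *)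

(* Defs.v *)
From HB Require Import structures.
From mathcomp Require Import all_boot all_order all_algebra.
From mathcomp Require Import sesquilinear complex.
From mathcomp Require Import all_classical all_reals all_analysis.

Set Implicit Arguments.
Unset Strict Implicit.
Unset Printing Implicit Defensive.

Import Order.TTheory GRing.Theory Num.Theory.
Import numFieldNormedType.Exports.

Local Open Scope classical_set_scope.
Local Open Scope ring_scope.

(* A Hilbert space may be real or complex.  Since orthogonality depends on the
   scalar field, everything below is parametrized by the kind of scalars. *)
Variant scalar_kind := RealScalars | ComplexScalars.

Definition scalar_field (R : realType) (k : scalar_kind) : numFieldType :=
  match k with
  | RealScalars => R
  | ComplexScalars => R[i]
  end.

Definition sconj (R : realType) (k : scalar_kind) :
    scalar_field R k -> scalar_field R k :=
  match k with
  | RealScalars => idfun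
  | ComplexScalars => @conjc R
  end.

Definition sRe (R : realType) (k : scalar_kind) : scalar_field R k -> R :=
  match k with
  | RealScalars => idfun
  | ComplexScalars => @complex.Re R
  end.

Definition sIm (R : realType) (k : scalar_kind) : scalar_field R k -> R :=
  match k with
  | RealScalars => fun=> 0
  | ComplexScalars => @complex.Im R
  end.

(* The scalar with given real and imaginary parts; for real scalars the
   second argument is ignored (it is only ever used at 0). *)
Definition smk (R : realType) (k : scalar_kind) : R -> R -> scalar_field R k :=
  match k with
  | RealScalars => fun a _ => a
  | ComplexScalars => @Complex R
  end.

(* The norm of a normed module over [scalar_field R k] takes its values in
   [scalar_field R k] (and is nonnegative, hence real); [hnorm] is the same
   norm with values in [R]. *)
Definition hnorm (R : realType) (k : scalar_kind)
    (H : normedModType (scalar_field R k)) (x : H) : R := sRe `|x|.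

Section LebesgueBochner.
Context d (T : measurableType d) (R : realType) (k : scalar_kind).
Context (H : completeNormedModType (scalar_field R k)).

(* The limit is required everywhere: an a.e. limit of simple functions agrees
   a.e. with an everywhere limit of simple functions, so the classes are the
   same, and [hnorm \o f] is measurable without completing the measure. *)
Definition strongly_measurable (f : T -> H) : Prop :=
  exists s : nat -> {fimfun T >-> H},
    (forall n y, measurable (s n @^-1` [set y])) /\
    (forall w, s n w @[n --> \oo] --> f w).

Context (mu : {measure set T -> \bar R}).

Definition bochner_norm (p : \bar R) (f : T -> H) : \bar R :=
  Lnorm mu p (fun w => (hnorm (f w))%:E).

(* Functions rather than a.e.-classes: all notions below are invariant under
   a.e. equality of strongly measurable functions. *)
Definition bochner_Lp (p : \bar R) : set (T -> H) :=
  [set f | strongly_measurable f /\ (bochner_norm p f < +oo)%E].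

Context (dot : {dot H for @sconj R k}).

Definition pairing (f g : T -> H) : scalar_field R k :=
  smk k (\int[mu]_w sRe (dot (f w) (g w))) (\int[mu]_w sIm (dot (f w) (g w))).

Definition Linfty_orthogonal (phi : T -> H) : set (T -> H) :=
  [set g | bochner_Lp +oo%E g /\ pairing g phi = 0].

Definition bochner_closure (p : \bar R) (A : set (T -> H)) : set (T -> H) :=
  [set f | bochner_Lp p f /\ forall e : R, 0 < e ->
    exists g, [/\ A g, bochner_Lp p g & (bochner_norm p (f \- g)%R < e%:E)%E]].

(* For [p < 2] the pairing of two functions in L^p may fail to be integrable,
   hence the closure of the bounded functions orthogonal to [phi]. *)
Definition Lp_orthogonal (p : \bar R) (phi f : T -> H) : Prop :=
  if (p < 2%:E)%E then bochner_closure p (Linfty_orthogonal phi) f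
  else pairing f phi = 0.

Definition hilbert_point (p : \bar R) (phi : T -> H) : Prop :=
  [/\ bochner_Lp p phi,
      ~ (\forall w \ae mu, phi w = 0) &
      forall f, bochner_Lp p f -> Lp_orthogonal p phi f ->
        (bochner_norm p phi <= bochner_norm p (phi \+ f)%R)%E].

End LebesgueBochner.

(* Main.v *)
Require Import Defs.
From HB Require Import structures.
From mathcomp Require Import all_boot all_order all_algebra.
From mathcomp Require Import sesquilinear complex.
From mathcomp Require Import all_classical all_reals all_analysis.
From mathcomp Require Import measurable_realfun ess_sup_inf ring lra.

(** Write [a = |phi|], and suppose that [a] takes values in two separated
    intervals [[r, s]] and [[t, M]], [0 < r], [s < t], on sets [A] and [B] of
    positive measure.  For [u] and [v] with [u * int_A a^2 + v * int_B a^2 = 0],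
    the bounded function [f = (u 1_A + v 1_B) phi] is orthogonal to [phi], and
    [|phi + f| = |1 + u 1_A + v 1_B| a].  For [p < oo], minimality of the norm
    in the direction of [f], from both sides, gives
    [u * int_A a^p + v * int_B a^p = 0]; so the ratios of [a^p = a^(p-2) a^2]
    to [a^2], integrated over [A] and over [B], are equal, which is impossible
    for [p <> 2] since [a^(p-2)] is strictly monotone in [a].  For [p = oo], take
    [B = {a >= t}] with [t] between [s] and the essential supremum: shrinking
    [phi] on [B] and slightly enlarging it on [A] lowers the norm.  Hence [a]
    has only one nonzero value.

    Conversely, if [a] is [C] on [E] and [0] elsewhere then [phi] is a Hilbert
    point for [p = oo]: if [|phi + f| <= N < C] almost everywhere, then
    [2 Re <f, phi> = |phi + f|^2 - |f|^2 - |phi|^2] is at most [N^2 - C^2] on [E]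
    and vanishes off [E], so its integral is negative. *)

Set Implicit Arguments.
Unset Strict Implicit.
Unset Printing Implicit Defensive.

Import Order.TTheory GRing.Theory Num.Theory.
Import numFieldNormedType.Exports.

Local Open Scope classical_set_scope.
Local Open Scope ring_scope.

(** * Real and complex scalars, treated uniformly *)

Section Scalars.
Context (R : realType) (k : scalar_kind).

(** The embedding of the reals into the scalars, through which scalar-valued norms are compared with
    real ones. *)
Definition rsc (r : R) : scalar_field R k := smk k r 0.

Lemma rscD x y : rsc (x + y) = rsc x + rsc y.
Proof.
by rewrite /rsc; case: k => //=; apply/eqP; rewrite eq_complex /= addr0 !eqxx.
Qed.

Lemma rsc1 : rsc 1 = 1. Proof. by rewrite /rsc; case: k. Qed.

Lemma rsc0 : rsc 0 = 0. Proof. by rewrite /rsc; case: k. Qed.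

Lemma rsc_gt0 e : 0 < e -> 0 < rsc e.
Proof. by rewrite /rsc; case: k => //= e0; rewrite ltcE /= eqxx. Qed.

Lemma sReD (x y : scalar_field R k) : sRe (x + y) = sRe x + sRe y.
Proof. by move: x y; case: k => //= -[? ?] [? ?]. Qed.

Lemma sRe_conj (x : scalar_field R k) : sRe (sconj x) = sRe x.
Proof. by move: x; case: k => //= -[? ?]. Qed.

Lemma sRe_le (x y : scalar_field R k) : x <= y -> sRe x <= sRe y.
Proof. by move: x y; case: k => //= -[? ?] [? ?]; rewrite lecE => /andP[]. Qed.

Lemma sRe_lt (x y : scalar_field R k) : x < y -> sRe x < sRe y.
Proof. by move: x y; case: k => //= -[? ?] [? ?]; rewrite ltcE => /andP[]. Qed.

Lemma sRe_rsc r : sRe (rsc r) = r.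
Proof. by rewrite /rsc; case: k. Qed.

Lemma nneg_scalarE (x : scalar_field R k) : 0 <= x -> x = rsc (sRe x).
Proof.
by rewrite /rsc; move: x; case: k => //= -[a b]; rewrite lecE /= => /andP[/eqP <-].
Qed.

Lemma rscM x y : rsc (x * y) = rsc x * rsc y.
Proof.
rewrite /rsc; case: k => //=; apply/eqP; rewrite eq_complex /=.
by rewrite !mulr0 !mul0r addr0 subr0 !eqxx.
Qed.

Lemma norm_rsc r : `|rsc r| = rsc `|r|.
Proof.
rewrite /rsc; case: k => //=.
by rewrite normc_def /= expr0n /= addr0 sqrtr_sqr.
Qed.

Lemma sIm_rsc r : sIm (rsc r) = 0. Proof. by rewrite /rsc; case: k. Qed.

Lemma smk_eq0 (a b : R) : smk k a b = 0 -> a = 0.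
Proof. by case: k => //= -[]. Qed.

End Scalars.

(** * The real-valued norm and the inner product *)

Section HilbertNorm.
Context (R : realType) (k : scalar_kind) (H : normedModType (scalar_field R k)).
Implicit Types x y : H.

Lemma normE x : `|x| = rsc k (hnorm x).
Proof. by rewrite -nneg_scalarE. Qed.

Lemma hnorm_ge0 x : 0 <= hnorm x.
Proof. by have /sRe_le := normr_ge0 x; rewrite -[X in sRe X]rsc0 sRe_rsc. Qed.

Lemma hnorm0 : hnorm (0 : H) = 0.
Proof. by rewrite /hnorm normr0 -[X in sRe X]rsc0 sRe_rsc. Qed.

Lemma hnorm_eq0 x : hnorm x = 0 -> x = 0.
Proof. by move=> x0; apply/normr0_eq0; rewrite normE x0 rsc0. Qed.

Lemma hnormD x y : hnorm (x + y) <= hnorm x + hnorm y.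
Proof. by rewrite /hnorm -sReD; apply: sRe_le; exact: ler_normD. Qed.

Lemma hnormN x : hnorm (- x) = hnorm x.
Proof. by rewrite /hnorm normrN. Qed.

Lemma hnorm_dist x y : `|hnorm x - hnorm y| <= hnorm (x - y).
Proof.
have := hnormD (x - y) y; have := hnormD (y - x) x.
rewrite !subrK -[hnorm (y - x)]hnormN opprB ler_norml => ? ?.
by apply/andP; split; lra.
Qed.

Lemma hnormZ r x : hnorm (rsc k r *: x) = `|r| * hnorm x.
Proof. by rewrite {1}/hnorm normrZ norm_rsc normE -rscM sRe_rsc. Qed.

Lemma cvg_hnorm (u : nat -> H) x : u n @[n --> \oo] --> x ->
  hnorm (u n) @[n --> \oo] --> hnorm x.
Proof.
move=> /cvgrPdist_lt ux; apply/cvgrPdist_lt => e e0.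
move: (ux _ (rsc_gt0 k e0)); apply: filterS => n xun.
by rewrite (le_lt_trans (hnorm_dist _ _))// -(sRe_rsc k e); exact: sRe_lt.
Qed.

Context (dot : {dot H for @sconj R k}).
Hypothesis norm_dot : forall x : H, `|x| ^+ 2 = dot x x.

Lemma dotxxE x : dot x x = rsc k (hnorm x ^+ 2).
Proof. by rewrite -norm_dot normE expr2 -rscM -expr2. Qed.

Lemma dot_rscZl r x : dot (rsc k r *: x) x = rsc k (r * hnorm x ^+ 2).
Proof. by rewrite linearZl_LR /= dotxxE rscM. Qed.

(** Hermitian symmetry makes the two cross terms conjugate, so their real parts agree. This
    expresses [sRe (dot x y)] through norms alone. *)
Lemma hnormD_sqr x y :
  hnorm (x + y) ^+ 2 = hnorm x ^+ 2 + hnorm y ^+ 2 + 2 * sRe (dot x y).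
Proof.
rewrite -[LHS](sRe_rsc k) -dotxxE linearDl /= !linearDr /= !sReD.
rewrite !dotxxE !sRe_rsc.
have -> : dot y x = sconj (dot x y).
  by have := @hermitian_subproof _ _ _ _ dot y x; rewrite expr0 mul1r.
rewrite sRe_conj; lra.
Qed.

End HilbertNorm.

(** * Strong measurability and Bochner norms *)

Section StronglyMeasurable.
Context d (T : measurableType d) (R : realType) (k : scalar_kind).
Context (H : completeNormedModType (scalar_field R k)).
Implicit Types f g : T -> H.

Lemma measurable_preimage_fimfun (s : {fimfun T >-> H}) :
  (forall y, measurable (s @^-1` [set y])) ->
  forall Y : set H, measurable (s @^-1` Y).
Proof.
move=> ms Y; have -> : s @^-1` Y =
    \bigcup_(y in range s `&` Y) (s @^-1` [set y]).
  apply/seteqP; split=> [x Yx|x [y [_ Yy]] /= -> //].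
  by exists (s x) => //; split => //; exists x.
by apply: fin_bigcup_measurable => [|y _]; [exact: finite_setIl|exact: ms].
Qed.

(** The simple approximants combine in the same way. With a coefficient supported on [A], this
    serves both sums and multiples of [phi] cut off to a set. *)
Lemma strongly_measurable_axpy (A : set T) (c : scalar_field R k) f g :
  measurable A -> strongly_measurable f -> strongly_measurable g ->
  strongly_measurable (fun x => (if x \in A then c else 0) *: f x + g x).
Proof.
move=> mA [s [ms sf]] [t [mt tg]].
pose h n x := (if x \in A then c else 0) *: s n x + t n x.
have hfin n : h n \in @fimfun T H.
  rewrite inE /=; apply: (@sub_finite_set _ _
    ((fun p : H * H => c *: p.1 + p.2) @` (range (s n) `*` range (t n)) `|`
     range (t n))).
    move=> _ [x _ <-]; rewrite /h; case: ifPn => _.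
      by left; exists (s n x, t n x) => //=; split; exists x.
    by right; rewrite scale0r add0r; exists x.
  rewrite finite_setU; split => //.
  by apply: finite_image; apply: finite_setX.
exists (fun n => fimfun_Sub (hfin n)); split=> [n y|x].
  (* Fixing one of the finitely many values [z] of [t n] leaves a condition on [s n] alone inside
     [A], and a constant condition outside. *)
  rewrite fimfun_valP; have -> : h n @^-1` [set y] =
      \bigcup_(z in range (t n)) (t n @^-1` [set z] `&`
      ((A `&` s n @^-1` [set v | c *: v + z = y]) `|`
       (~` A `&` [set _ | z = y]))).
    apply/seteqP; split=> [x /= hy|x [z _ [/= tz]]] /=.
      exists (t n x); first by exists x.
      split=> //; move: hy; rewrite /h; case: ifPn => xA; rewrite ?inE in xA.
        by left; split=> //; exact: set_mem.
      by rewrite scale0r add0r; right; split=> // /mem_set; apply/negP.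
    rewrite /h tz => -[[xA hz]|[xA ->]]; first by rewrite mem_set.
    by rewrite memNset// scale0r add0r.
  apply: fin_bigcup_measurable => // z _; apply: measurableI; first exact: mt.
  apply: measurableU; apply: measurableI => //.
  - exact: measurable_preimage_fimfun.
  - exact: measurableC.
  - case: (pselect (z = y)) => zy.
      by rewrite (_ : [set _ | _] = setT)//; apply/seteqP; split.
    by rewrite (_ : [set _ | _] = set0)//; apply/seteqP; split.
apply: cvgD => //; apply: cvgZr; exact: sf.
Qed.

Lemma strongly_measurableD f g : strongly_measurable f ->
  strongly_measurable g -> strongly_measurable (f \+ g).
Proof.
move=> sf sg; rewrite (_ : f \+ g =
    fun x => (if x \in [set: T] then 1 else 0) *: f x + g x).
  exact: strongly_measurable_axpy.
by apply/funext => x; rewrite in_setT scale1r.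
Qed.

Lemma strongly_measurable0 : strongly_measurable ((fun=> 0) : T -> H).
Proof.
exists (fun=> cst_fimfun 0); split=> [n y|x]; last exact: cvg_cst.
rewrite /= (_ : _ @^-1` _ = [set _ | (0 : H) = y])//.
case: (pselect ((0 : H) = y)) => zy.
  by rewrite (_ : [set _ | _] = setT)//; apply/seteqP; split.
by rewrite (_ : [set _ | _] = set0)//; apply/seteqP; split.
Qed.

(** Simple approximants have measurable preimages of arbitrary sets, so their norms are measurable,
    and these converge pointwise to the norm of [f]. *)
Lemma measurable_hnorm f : strongly_measurable f ->
  measurable_fun setT (fun x => hnorm (f x)).
Proof.
move=> [s [ms sf]].
apply: (@measurable_fun_cvg _ _ _ _ (fun n x => hnorm (s n x))).
  move=> n _ Y mY; rewrite setTI.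
  exact: (measurable_preimage_fimfun (ms n) ((@hnorm _ _ H) @^-1` Y)).
by move=> x _; apply: cvg_hnorm.
Qed.

Context (mu : probability T R).

Lemma bochner_norm_pinftyE f :
  bochner_norm mu +oo%E f = ess_sup mu (fun x => (hnorm (f x))%:E).
Proof.
rewrite /bochner_norm unlock /= probability_setT lte01.
by congr ess_sup; apply/funext => x /=; rewrite ger0_norm ?hnorm_ge0.
Qed.

Lemma bochner_norm_pinfty_le f (K : R) : (\forall x \ae mu, hnorm (f x) <= K) <->
  (bochner_norm mu +oo%E f <= K%:E)%E.
Proof.
rewrite bochner_norm_pinftyE; split.
  by move=> fK; apply/ess_supP; apply: filterS fK => x; rewrite lee_fin.
by move/ess_supP; apply: filterS => x; rewrite lee_fin.
Qed.

Lemma bochner_norm_powR (p : R) f : 0 < p ->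
  (bochner_norm mu p%:E f `^ p = \int[mu]_x (hnorm (f x) `^ p)%:E)%E.
Proof.
move=> p0; rewrite /bochner_norm poweR_Lnorm ?gt_eqF//.
apply: eq_integral => x _ /=; by rewrite ger0_norm ?hnorm_ge0.
Qed.

Lemma bounded_bochner_Lp (p : \bar R) f (K : R) : (1 <= p)%E ->
  strongly_measurable f -> (forall x, hnorm (f x) <= K) -> bochner_Lp mu p f.
Proof.
move=> p1 sf fK; split => //; case: p p1 => [p| |] // p1; last first.
  apply: (@le_lt_trans _ _ K%:E); last exact: ltry.
  by apply/bochner_norm_pinfty_le; exact: aeW.
rewrite lee_fin in p1; have p0 : 0 < p by exact: lt_le_trans p1.
have K0 : 0 <= K.
  have [x _] : [set: T] !=set0.
    apply/set0P/eqP => T0; have := @probability_setT _ _ _ mu.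
    by rewrite T0 measure0 => /eqP; rewrite eqe eq_sym oner_eq0.
  exact: le_trans (hnorm_ge0 _) (fK x).
rewrite /bochner_norm unlock; apply: poweR_lty.
apply: (@le_lt_trans _ _ (\int[mu]_x (K `^ p)%:E)%E).
  apply: ge0_le_integral => //.
  - by move=> x _; exact: poweR_ge0.
  - apply/measurable_EFinP => /=.
    apply: (@measurableT_comp _ _ _ _ _ _ (fun x => x `^ p)) => //.
    by apply: measurableT_comp => //; exact: measurable_hnorm.
  - move=> x _ /=; rewrite lee_fin ge0_ler_powR ?nnegrE ?(ltW p0)//.
    by rewrite ger0_norm ?hnorm_ge0.
by rewrite integral_cst//= probability_setT mule1 ltry.
Qed.

End StronglyMeasurable.

(** * Two-step multipliers and comparison of integrals *)

Definition step (T : Type) (R : nmodType) (A B : set T) (u v : R) (x : T) : R :=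
  (if x \in A then u else 0) + (if x \in B then v else 0).

(** Disjointness leaves at most one active term, and [g 0 = 0] takes care of the points outside both
    sets. *)
Lemma step_comp (T : Type) (R : nmodType) (A B : set T) (u v : R) (g : R -> R) x :
  A `&` B = set0 -> g 0 = 0 ->
  g (step A B u v x) = step A B (g u) (g v) x.
Proof.
move=> AB0 g0; rewrite /step; case: ifPn => xA; case: ifPn => xB;
  rewrite ?addr0 ?add0r ?g0//.
by have : (A `&` B) x; [split; exact: set_mem|rewrite AB0].
Qed.

Section Integrals.
Context d (T : measurableType d) (R : realType) (mu : probability T R).
Implicit Types (A B : set T) (F a : T -> R).

Lemma Rintegral_step A B u v F : measurable A -> measurable B ->
  mu.-integrable A (EFin \o F) -> mu.-integrable B (EFin \o F) ->
  mu.-integrable setT (EFin \o (fun x => step A B u v x * F x)) /\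
  \int[mu]_x (step A B u v x * F x) =
    u * \int[mu]_(x in A) F x + v * \int[mu]_(x in B) F x.
Proof.
move=> mA mB iA iB.
have iZ D w : measurable D -> mu.-integrable D (EFin \o F) ->
    mu.-integrable setT (EFin \o (fun x => w * (F \_ D) x)).
  move=> mD iD.
  have -> : EFin \o (fun x => w * (F \_ D) x) =
      (fun x => w%:E * (EFin \o (F \_ D)) x)%E by [].
  by apply: integrableZl => //; rewrite -restrict_EFin -integrable_mkcond.
have iF D : measurable D -> mu.-integrable D (EFin \o F) ->
    mu.-integrable setT (EFin \o (F \_ D)).
  by move=> mD iD; rewrite -restrict_EFin -integrable_mkcond.
have -> : (fun x => step A B u v x * F x) =
    (fun x => u * (F \_ A) x + v * (F \_ B) x).
  apply/funext => x; rewrite /step !patchE.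
  by case: ifPn => _; case: ifPn => _; rewrite ?mulr0 ?mul0r ?addr0 ?add0r ?mul0r ?mulrDl.
split.
  have -> : EFin \o (fun x => u * (F \_ A) x + v * (F \_ B) x) =
    (EFin \o (fun x => u * (F \_ A) x)) \+ (EFin \o (fun x => v * (F \_ B) x)) by [].
  by apply: integrableD => //; exact: iZ.
rewrite RintegralD//; [|exact: iZ|exact: iZ].
by rewrite !RintegralZl//; [rewrite -!Rintegral_mkcond|exact: iF|exact: iF].
Qed.

Lemma bounded_integrable D F (K : R) : measurable D -> measurable_fun D F ->
  (forall x, D x -> `|F x| <= K) -> mu.-integrable D (EFin \o F).
Proof.
move=> mD mF FK; apply: measurable_bounded_integrable => //.
  by rewrite (le_lt_trans (probability_le1 _ mD))// ltry.
exists K; split; first exact: num_real.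
by move=> x Kx y Dy; exact: le_trans (FK _ Dy) (ltW Kx).
Qed.

Lemma Rintegral_gt0 D F (c : R) : measurable D -> (0 < mu D)%E ->
  mu.-integrable D (EFin \o F) -> 0 < c -> (forall x, D x -> c <= F x) ->
  0 < \int[mu]_(x in D) F x.
Proof.
move=> mD D0 iF c0 cF.
have Dfin : mu D \is a fin_num.
  by rewrite ge0_fin_numE// (le_lt_trans (probability_le1 _ mD))// ltry.
apply: (@lt_le_trans _ _ (\int[mu]_(x in D) c)); last first.
  by apply: le_Rintegral => //; apply: (@bounded_integrable _ _ `|c|).
by rewrite Rintegral_cst// mulr_gt0// fine_gt0// D0 ltey_eq Dfin.
Qed.

(** Integrating the pointwise bounds and multiplying by the positive integrals of [G] carries
    [L < U] over to the ratios of the integrals, stated without division. *)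
Lemma cross_Rintegral D1 D2 F G (L U : R) : measurable D1 -> measurable D2 ->
  mu.-integrable D1 (EFin \o F) -> mu.-integrable D1 (EFin \o G) ->
  mu.-integrable D2 (EFin \o F) -> mu.-integrable D2 (EFin \o G) ->
  (forall x, D1 x -> F x <= L * G x) -> (forall x, D2 x -> U * G x <= F x) ->
  L < U -> 0 < \int[mu]_(x in D1) G x -> 0 < \int[mu]_(x in D2) G x ->
  (\int[mu]_(x in D2) G x) * (\int[mu]_(x in D1) F x) <
  (\int[mu]_(x in D1) G x) * (\int[mu]_(x in D2) F x).
Proof.
move=> mD1 mD2 iF1 iG1 iF2 iG2 FL UF LU.
have iZ D w : measurable D -> mu.-integrable D (EFin \o G) ->
    mu.-integrable D (EFin \o (fun x => w * G x)).
  by move=> mD iD; exact: (integrableZl mD w iD).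
have : \int[mu]_(x in D1) F x <= L * \int[mu]_(x in D1) G x.
  by rewrite -RintegralZl//; apply: le_Rintegral => //; exact: iZ.
have : U * \int[mu]_(x in D2) G x <= \int[mu]_(x in D2) F x.
  by rewrite -RintegralZl//; apply: le_Rintegral => //; exact: iZ.
set f1 := \int[mu]_(x in D1) F x; set f2 := \int[mu]_(x in D2) F x.
set g1 := \int[mu]_(x in D1) G x; set g2 := \int[mu]_(x in D2) G x.
move=> Uf2 f1L g10 g20.
apply: (@le_lt_trans _ _ (g2 * (L * g1))); first by rewrite ler_pM2l.
apply: (@lt_le_trans _ _ (g1 * (U * g2))); last by rewrite ler_pM2l.
by rewrite mulrCA [ltRHS]mulrCA [g1 * g2]mulrC ltr_pM2r// mulr_gt0.
Qed.


(** The value [C] is the supremum of the levels [q] for which [0 < a <= q] holds almost nowhere.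
    Nonzero values below [C] are then negligible, and the dichotomy makes those above [C] negligible
    too. *)
Lemma two_valued_ae a : measurable_fun setT a -> (forall x, 0 <= a x) ->
  ~ (\forall x \ae mu, a x = 0) ->
  (forall r s t M, 0 < r -> s < t ->
    mu.-negligible [set x | r <= a x <= s] \/
    mu.-negligible [set x | t <= a x <= M]) ->
  exists2 C, 0 < C & \forall x \ae mu, a x = 0 \/ a x = C.
Proof.
move=> ma a0 an0 adich.
(* Both sets are countable unions of level sets to which [adich] applies: one family starts at
   [1/(m+1)], the other leaves a gap [1/(n+1)] above [q]. *)
have small_or_large q : mu.-negligible [set x | 0 < a x <= q] \/
    mu.-negligible [set x | q < a x].
  apply: contrapT => /not_orP[nsmall nlarge].
  have [m nm] : exists m : nat,
      ~ mu.-negligible [set x | m.+1%:R^-1 <= a x <= q].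
    apply: contrapT => /forallNP nm; apply: nsmall.
    apply: negligibleS (negligible_bigcup (fun m => contrapT (nm m))).
    move=> x /= /andP[ax axq].
    have [m am] := ltr_add_invr ax.
    by exists m => //=; rewrite axq andbT ltW// -[ltLHS]add0r.
  have [n nn] : exists n : nat,
      ~ mu.-negligible [set x | q + n.+1%:R^-1 <= a x <= q + n.+1%:R].
    apply: contrapT => /forallNP nn; apply: nlarge.
    apply: negligibleS (negligible_bigcup (fun n => contrapT (nn n))).
    move=> x /= qax; have [n an] := ltr_add_invr qax.
    (* The index must give both [1/(n+1) <= a x - q] and [a x - q <= n+1], hence a maximum. *)
    exists (maxn n (Num.truncn (a x - q))) => //=; apply/andP; split.
      rewrite (le_trans _ (ltW an))// lerD2l lef_pV2 ?posrE// ler_nat.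
      by rewrite ltnS leq_maxl.
    rewrite -lerBlDl (le_trans (ltW (truncnS_gt _)))// ler_nat ltnS.
    exact: leq_maxr.
  by case: (adich m.+1%:R^-1 q (q + n.+1%:R^-1) (q + n.+1%:R)) => //;
    rewrite ?ltrDl ?invr_gt0.
pose S := [set q | mu.-negligible [set x | 0 < a x <= q]].
have S0 : S 0.
  rewrite /S /= (_ : [set x | _] = set0); first exact: negligible_set0.
  by apply/seteqP; split=> x //= /andP[/lt_le_trans /[apply]]; rewrite ltxx.
have Sle q q' : q <= q' -> S q' -> S q.
  move=> qq'; apply: negligibleS => x /= /andP[-> axq] /=.
  exact: le_trans qq'.
(* If every level were in [S], the integer levels would exhaust the nonzero values of [a], and [a]
   would vanish almost everywhere. *)
have [q0 Sq0] : exists q, ~ S q.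
  apply: contrapT => /forallNP nS; apply: an0.
  have := negligible_bigcup (fun n : nat => contrapT (nS n%:R)).
  apply: negligibleS => x /= /eqP ax0.
  have ax : 0 < a x by rewrite lt_def ax0 a0.
  by exists (Num.truncn (a x)).+1 => //=; rewrite ax ltW// truncnS_gt.
have hS : has_sup S.
  split; first by exists 0.
  exists q0 => q Sq; rewrite leNgt; apply/negP => /ltW q0q; exact: Sq0 (Sle _ _ q0q Sq).
set C := sup S.
have ltC q : q < C -> S q.
  rewrite -subr_gt0 => qC; have [q' Sq'] := sup_adherent qC hS.
  by rewrite subKr => /ltW /Sle; apply.
have gtC q : C < q -> mu.-negligible [set x | q < a x].
  move=> Cq; case: (small_or_large q) => // Sq.
  by have := sup_upper_bound hS Sq; rewrite leNgt Cq.
have aeC : \forall x \ae mu, a x = 0 \/ a x = C.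
  have nlt : mu.-negligible [set x | 0 < a x < C].
    have Cn (n : nat) : C - n.+1%:R^-1 < C by rewrite ltrBlDr ltrDl invr_gt0.
    apply: negligibleS (negligible_bigcup (fun n => ltC _ (Cn n))).
    move=> x /= /andP[ax axC]; have [n an] := ltr_add_invr axC.
    by exists n => //=; rewrite ax lerBrDr ltW.
  have ngt : mu.-negligible [set x | C < a x].
    have Cn (n : nat) : C < C + n.+1%:R^-1 by rewrite ltrDl invr_gt0.
    apply: negligibleS (negligible_bigcup (fun n => gtC _ (Cn n))).
    by move=> x /= axC; have [n an] := ltr_add_invr axC; exists n.
  apply: negligibleS (negligibleU nlt ngt) => x /= /not_orP[/eqP ax0 /eqP axC].
  have ax : 0 < a x by rewrite lt_def ax0 a0.
  by move: axC; rewrite neq_lt => /orP[axC|axC]; [left; rewrite ax|right].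
(* [S] contains [0], so [C] is nonnegative, and [C = 0] would make [a] vanish almost everywhere. *)
exists C => //; rewrite lt_def (sup_upper_bound hS)// andbT.
apply/eqP => C0; apply: an0; apply: filterS aeC => x.
by rewrite C0 => -[].
Qed.

End Integrals.

(** * First-order condition for a minimum *)

(** The right-hand side, as a function of [e], has a local minimum at [0], where its derivative is
    [p * (u * P + v * Q)]. *)
Lemma stationary_powR (R : realType) (p u v P Q : R) : 0 < p ->
  (forall e, 0 < 1 + e * u -> 0 < 1 + e * v ->
    P + Q <= P * (1 + e * u) `^ p + Q * (1 + e * v) `^ p) -> u * P + v * Q = 0.
Proof.
(* For [|e| < D] both [|e * u|] and [|e * v|] stay below [1], so the bases are positive; the added
   [1] covers [u = v = 0]. *)
move=> p0 hmin; pose D : R := 1 / (`|u| + `|v| + 1).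
have uv0 : 0 < `|u| + `|v| + 1 by rewrite ltr_wpDl// addr_ge0.
have D0 : 0 < D by exact: divr_gt0.
have pos (e w : R) : e \in `]- D, D[%R -> `|w| <= `|u| + `|v| -> 0 < 1 + e * w.
  rewrite in_itv /= -ltr_norml /D ltr_pdivlMr// => eD wuv.
  have : `|e * w| < 1.
    rewrite normrM (le_lt_trans _ eD)// ler_wpM2l//; lra.
  by rewrite ltr_norml => /andP[+ _]; lra.
have dpow (e w : R) : 0 < 1 + e * w -> is_derive e 1 (fun t => (1 + t * w) `^ p)
    (p * (1 + e * w) `^ (p - 1) * w).
  move=> ew; apply: (@is_derive1_comp _ (@powR R ^~ p) (fun t : R => 1 + t * w)).
    exact: is_derive1_powR.
  have -> : (fun t : R => 1 + t * w) = cst 1 + w *: id.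
    by apply/funext => t; rewrite /GRing.scale /= mulrC.
  by apply: is_derive_eq; rewrite add0r /GRing.scale /= mulr1.
pose h (t : R) := P * (1 + t * u) `^ p + Q * (1 + t * v) `^ p.
have dh (e : R) : e \in `]- D, D[%R -> is_derive e 1 h
    (P * (p * (1 + e * u) `^ (p - 1) * u) + Q * (p * (1 + e * v) `^ (p - 1) * v)).
  move=> eD.
  have -> : h = (P *: (fun t => (1 + t * u) `^ p)) +
     (Q *: (fun t => (1 + t * v) `^ p)) by [].
  apply: is_deriveD; apply: is_deriveZ; apply: dpow; apply: pos => //.
    by rewrite lerDl.
  by rewrite lerDr.
have D00 : (0 : R) \in `]- D, D[%R by rewrite in_itv /= oppr_lt0 D0.
have h0 : is_derive (0 : R) 1 h 0.
  apply: (@derive1_at_min _ _ (- D) D) => // [|t tD|t tD].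
  - by rewrite (@le_trans _ _ 0)// ?oppr_le0 ltW.
  - by case: (dh _ tD).
  - rewrite /h !mul0r !addr0 !powR1 !mulr1; apply: hmin; apply: pos => //.
      by rewrite lerDl.
    by rewrite lerDr.
have := dh _ D00; rewrite !mul0r !addr0 !powR1 !mulr1 => h1.
have : P * (p * u) + Q * (p * v) = 0.
  by rewrite -(@derive_val _ _ _ _ _ _ _ h1) (@derive_val _ _ _ _ _ _ _ h0).
have p1 : p != 0 by rewrite gt_eqF.
move=> E; apply: (mulfI p1); rewrite mulr0 -E; ring.
Qed.

(** * Perturbations of [phi] by real multiples of itself *)

Section Radial.
Context d (T : measurableType d) (R : realType) (mu : probability T R).
Context (k : scalar_kind) (H : completeNormedModType (scalar_field R k)).
Context (dot : {dot H for @sconj R k}).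
Hypothesis norm_dot : forall x : H, `|x| ^+ 2 = dot x x.
Context (phi : T -> H) (phi_meas : strongly_measurable phi).
Local Notation a := (fun x => hnorm (phi x)).

Lemma measurable_level (r s : R) : measurable [set x | r <= a x <= s].
Proof.
have := measurable_hnorm phi_meas measurableT (measurable_itv `[r, s]).
rewrite setTI (_ : _ @^-1` _ = [set x | r <= a x <= s])//.
Qed.

Lemma measurable_powR_hnorm (p : R) (D : set T) :
  measurable_fun D (fun x => a x `^ p).
Proof.
apply: (@measurable_funS _ _ _ _ setT) => //.
apply: (@measurableT_comp _ _ _ _ _ _ (fun x => x `^ p)) => //.
exact: measurable_hnorm.
Qed.

Lemma measurable_sqr_hnorm (D : set T) : measurable_fun D (fun x => a x ^+ 2).
Proof.
apply: (@measurable_funS _ _ _ _ setT) => //.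
by apply: measurable_funX; exact: measurable_hnorm.
Qed.

Lemma integrable_sqr (D : set T) (M : R) : measurable D ->
  (forall x, D x -> a x <= M) -> mu.-integrable D (EFin \o (fun x => a x ^+ 2)).
Proof.
move=> mD aM; apply: (@bounded_integrable _ _ _ _ _ _ (M ^+ 2)) => //.
  exact: measurable_sqr_hnorm.
move=> x Dx; rewrite ger0_norm ?sqr_ge0// ler_sqr ?nnegrE ?hnorm_ge0//.
  exact: aM.
by rewrite (le_trans (hnorm_ge0 _) (aM _ Dx)).
Qed.

(** The perturbation [f = step A B u v *: phi] is bounded because [phi] is bounded on [A] and [B],
    and the linear constraint on [u] and [v] is its orthogonality to [phi]. *)
Lemma hilbert_point_radial (p : \bar R) (A B : set T) (M u v : R) : (1 <= p)%E ->
  hilbert_point mu dot p phi -> measurable A -> measurable B -> A `&` B = set0 ->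
  (forall x, A x -> a x <= M) -> (forall x, B x -> a x <= M) ->
  u * \int[mu]_(x in A) (a x ^+ 2) + v * \int[mu]_(x in B) (a x ^+ 2) = 0 ->
  (bochner_norm mu p phi <=
   bochner_norm mu p (fun x => rsc k (1 + step A B u v x) *: phi x))%E.
Proof.
move=> p1 [_ _ hp] mA mB AB0 aA aB uv0.
pose f x := rsc k (step A B u v x) *: phi x.
have sf : strongly_measurable f.
  have -> : f = fun x => (if x \in A then rsc k u else 0) *: phi x +
      ((if x \in B then rsc k v else 0) *: phi x + 0).
    apply/funext => x; rewrite /f addr0 -scalerDl /step rscD.
    by congr ((_ + _) *: _); case: ifP => // _; rewrite rsc0.
  apply: strongly_measurable_axpy => //.
  apply: strongly_measurable_axpy => //.
  exact: strongly_measurable0.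
have fbnd x : hnorm (f x) <= (`|u| + `|v|) * `|M|.
  rewrite /f hnormZ /step; case: ifPn => xA; case: ifPn => xB.
  - have a_le : a x <= `|M|.
      by apply: le_trans (ler_norm M); apply: aA; exact: set_mem.
    by rewrite ler_pM ?hnorm_ge0// ler_normD.
  - have a_le : a x <= `|M|.
      by apply: le_trans (ler_norm M); apply: aA; exact: set_mem.
    by rewrite addr0 ler_pM ?hnorm_ge0// lerDl.
  - have a_le : a x <= `|M|.
      by apply: le_trans (ler_norm M); apply: aB; exact: set_mem.
    by rewrite add0r ler_pM ?hnorm_ge0// lerDr.
  - by rewrite addr0 normr0 mul0r mulr_ge0// addr_ge0.
have pf0 : pairing mu dot f phi = 0.
  (* The integrand is a real multiple of [a^2]: its real part yields the constraint, its imaginary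
     part is [0]. *)
  rewrite /pairing -[RHS](rsc0 R k) /rsc; congr smk.
    rewrite -uv0 -(Rintegral_step u v mA mB (integrable_sqr mA aA)
      (integrable_sqr mB aB)).2.
    by apply: eq_Rintegral => x _; rewrite /f (dot_rscZl norm_dot) sRe_rsc.
  under eq_Rintegral do rewrite /f (dot_rscZl norm_dot) sIm_rsc.
  by rewrite Rintegral_cst// mul0r.
have -> : (fun x => rsc k (1 + step A B u v x) *: phi x) = phi \+ f.
  by apply/funext => x; rewrite /f /= rscD rsc1 scalerDl scale1r.
have fLp q : (1 <= q)%E -> bochner_Lp mu q f.
  by move=> q1; exact: bounded_bochner_Lp fbnd.
apply: hp; first exact: fLp.
(* For [p < 2] membership in a closure is required; [f] is itself bounded and orthogonal, so it
   approximates itself at distance [0]. *)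
rewrite /Lp_orthogonal; case: ifPn => // _.
split=> [|e e0]; first exact: fLp.
exists f; split; [split => //; apply: fLp|exact: fLp|].
  by rewrite leey.
rewrite /bochner_norm (_ : (fun _ => _) = cst 0%E).
  by rewrite Lnorm0 ?lte_fin// gt_eqF// (lt_le_trans _ p1)// lte01.
by apply/funext => x /=; rewrite subrr hnorm0.
Qed.

End Radial.

(** * The dichotomy of levels for finite exponents *)

Section Dichotomy.
Context d (T : measurableType d) (R : realType) (mu : probability T R).
Context (k : scalar_kind) (H : completeNormedModType (scalar_field R k)).
Context (dot : {dot H for @sconj R k}).
Hypothesis norm_dot : forall x : H, `|x| ^+ 2 = dot x x.
Context (phi : T -> H) (phi_meas : strongly_measurable phi).
Local Notation a := (fun x => hnorm (phi x)).

Lemma measure_gt0_nonempty (D : set T) : (0 < mu D)%E -> D !=set0.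
Proof. by move=> D0; apply/set0P/eqP => D00; rewrite D00 measure0 ltxx in D0. Qed.

Lemma not_negligible_gt0 (D : set T) :
  measurable D -> ~ mu.-negligible D -> (0 < mu D)%E.
Proof.
by move=> mD; rewrite negligibleP// lt_def measure_ge0 andbT => /eqP.
Qed.

Lemma disjoint_levels (r s t M : R) : s < t ->
  [set x | r <= a x <= s] `&` [set x | t <= a x <= M] = set0.
Proof.
move=> st; apply/seteqP; split => x //= [/andP[_ axs] /andP[tax _]].
by move: (lt_le_trans st (le_trans tax axs)); rewrite ltxx.
Qed.

Lemma powR_sqrE (p b : R) : 0 < b -> b `^ p = b `^ (p - 2) * b ^+ 2.
Proof.
move=> b0; rewrite -(powR_mulrn 2 (ltW b0)) -powRD ?subrK//.
by rewrite (gt_eqF b0) implybT.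
Qed.

(** The constraint is linear, so [(e * u, e * v)] satisfies it for every real [e], and
    [stationary_powR] applies with the integrals of [a^p] over [A] and [B] as [P] and [Q]. *)
Lemma hilbert_point_fin_stationary (p : R) (A B : set T) (M u v : R) : 1 <= p ->
  hilbert_point mu dot p%:E phi -> measurable A -> measurable B ->
  A `&` B = set0 ->
  (forall x, A x -> a x <= M) -> (forall x, B x -> a x <= M) ->
  u * \int[mu]_(x in A) (a x ^+ 2) + v * \int[mu]_(x in B) (a x ^+ 2) = 0 ->
  u * \int[mu]_(x in A) (a x `^ p) + v * \int[mu]_(x in B) (a x `^ p) = 0.
Proof.
move=> p1 hp mA mB AB0 aA aB uv0.
have p0 : 0 < p by exact: lt_le_trans p1.
have [[_ phi_lty] _ _] := hp.
have ip : mu.-integrable setT (EFin \o (fun x => a x `^ p)).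
  apply/integrableP; split.
    by apply/measurable_EFinP; exact: measurable_powR_hnorm.
  under eq_integral => x _ do rewrite /= ger0_norm ?powR_ge0//.
  by rewrite -bochner_norm_powR// poweR_lty.
have ipS D : measurable D -> mu.-integrable D (EFin \o (fun x => a x `^ p)).
  by move=> mD; apply: integrableS ip.
apply: (stationary_powR p0) => e eu ev.
have := @hilbert_point_radial _ _ _ _ _ _ _ norm_dot _ phi_meas p%:E A B M
  (e * u) (e * v) p1 hp mA mB AB0 aA aB.
rewrite -!mulrA -mulrDr uv0 mulr0 => /(_ erefl) le_norm.
have := gt0_ler_poweR (ltW p0) _ _ le_norm.
rewrite !in_itv /= !leey !andbT => /(_ (Lnorm_ge0 _ _ _) (Lnorm_ge0 _ _ _)).
rewrite !bochner_norm_powR//.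
(* Subtracting [1] gives [c 0 = 0], so the perturbed [a^p] is [a^p] plus a term supported on [A] and
   [B], and the integral of [a^p] over the whole space cancels. *)
pose c w := `|1 + w| `^ p - 1.
have c0 : c 0 = 0 by rewrite /c addr0 normr1 powR1 subrr.
have -> : (fun x => (hnorm (rsc k (1 + step A B (e * u) (e * v) x) *: phi x) `^ p)%:E) =
    EFin \o (fun x => step A B (c (e * u)) (c (e * v)) x * a x `^ p + a x `^ p).
  apply/funext => x /=; rewrite hnormZ powRM ?hnorm_ge0// -(step_comp _ _ _ AB0 c0).
  by rewrite /c; congr EFin; ring.
have [iS ES] := Rintegral_step (c (e * u)) (c (e * v)) mA mB (ipS _ mA) (ipS _ mB).
have iSD : mu.-integrable setT (EFin \o
    (fun x => step A B (c (e * u)) (c (e * v)) x * a x `^ p + a x `^ p)).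
  have := integrableD measurableT iS ip; exact.
move=> /(fine_le (integrable_fin_num measurableT ip) (integrable_fin_num measurableT iSD)).
have := RintegralD measurableT iS ip; rewrite ES /Rintegral => -> .
rewrite /c (gtr0_norm eu) (gtr0_norm ev).
lra.
Qed.

Lemma hilbert_point_fin_dichotomy (p r s t M : R) : 1 <= p -> p != 2 ->
  hilbert_point mu dot p%:E phi -> 0 < r -> s < t ->
  mu.-negligible [set x | r <= a x <= s] \/ mu.-negligible [set x | t <= a x <= M].
Proof.
move=> p1 p2 hp r0 st; set A := [set x | _ <= _ <= s]; set B := [set x | t <= _ <= _].
apply: contrapT => /not_orP[nA nB].
have mA : measurable A by exact: measurable_level.
have mB : measurable B by exact: measurable_level.
have A0 := not_negligible_gt0 mA nA; have B0 := not_negligible_gt0 mB nB.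
have [xA /= /andP[rxA xAs]] := measure_gt0_nonempty A0.
have [xB /= /andP[txB xBM]] := measure_gt0_nonempty B0.
have s0 : 0 < s by lra.
have t0 : 0 < t by lra.
have sM : s <= M by lra.
have aA x : A x -> a x <= M by move=> /= /andP[_ /le_trans]; apply.
have aB x : B x -> a x <= M by move=> /= /andP[].
have iA2 := integrable_sqr mu phi_meas mA aA; have iB2 := integrable_sqr mu phi_meas mB aB.
have ip D : measurable D -> (forall x, D x -> a x <= M) ->
    mu.-integrable D (EFin \o (fun x => a x `^ p)).
  move=> mD aD; apply: (@bounded_integrable _ _ _ _ _ _ (M `^ p)) => //.
    exact: measurable_powR_hnorm.
  move=> x Dx; rewrite ger0_norm ?powR_ge0// ge0_ler_powR ?nnegrE ?hnorm_ge0//.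
  - lra.
  - lra.
  - exact: aD.
have iAp := ip _ mA aA; have iBp := ip _ mB aB.
have A2 : 0 < \int[mu]_(x in A) (a x ^+ 2).
  apply: (Rintegral_gt0 mA A0 iA2 (exprn_gt0 2 r0)) => x /= /andP[rx _].
  by rewrite ler_sqr ?nnegrE ?hnorm_ge0// ltW.
have B2 : 0 < \int[mu]_(x in B) (a x ^+ 2).
  apply: (Rintegral_gt0 mB B0 iB2 (exprn_gt0 2 t0)) => x /= /andP[tx _].
  by rewrite ler_sqr ?nnegrE ?hnorm_ge0// ltW.
(* These weights solve the constraint; stationarity then equates the cross products of the integrals
   of [a^2] and [a^p]. *)
have := hilbert_point_fin_stationary (u := \int[mu]_(x in B) (a x ^+ 2))
   (v := - \int[mu]_(x in A) (a x ^+ 2)) p1 hp mA mB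
   (disjoint_levels _ _ st) aA aB.
rewrite mulNr mulrC subrr => /(_ erefl).
move=> /eqP; rewrite mulNr subr_eq0 => /eqP.
have pow_le (q x y : R) : 0 <= q -> 0 < x -> x <= y -> x `^ q <= y `^ q.
  by move=> q0 x0 xy; rewrite ge0_ler_powR ?nnegrE ?(ltW x0)// (le_trans (ltW x0)).
have pow_ge (q x y : R) : q <= 0 -> 0 < x -> x <= y -> y `^ q <= x `^ q.
  move=> q0 x0 xy; rewrite -(opprK q) 2!(powRN _ (- q)) lef_pV2 ?posrE ?powR_gt0//; last first.
    exact: lt_le_trans xy.
  by apply: pow_le => //; rewrite oppr_ge0.
have : p - 2 != 0 by rewrite subr_eq0.
(* The ratio [a^(p-2)] decreases in [a] for [p < 2] and increases for [p > 2], so [A] and [B]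
   exchange roles in [cross_Rintegral]. In both cases the equality contradicts its strict
   conclusion, and only its premises remain to be checked. *)
rewrite neq_lt => /orP[q0|q0].
- have := @cross_Rintegral _ _ _ mu B A (fun x => a x `^ p) (fun x => a x ^+ 2)
    (t `^ (p - 2)) (s `^ (p - 2)) mB mA iBp iB2 iAp iA2.
  move=> lt_int eq_int; move: lt_int; rewrite eq_int ltxx => lt_int.
  suff: false by []; apply: lt_int => //.
  + move=> x /= /andP[tx _]; have ax0 : 0 < a x by lra.
    by rewrite (powR_sqrE p ax0) ler_wpM2r ?sqr_ge0// pow_ge// ltW.
  + move=> x /= /andP[rx xs]; have ax0 : 0 < a x by lra.
    by rewrite (powR_sqrE p ax0) ler_wpM2r ?sqr_ge0// pow_ge// ltW.
  + rewrite -(opprK (p - 2)) 2!(powRN _ (- (p - 2))) ltf_pV2 ?posrE ?powR_gt0//.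
    by rewrite gt0_ltr_powR ?nnegrE ?oppr_gt0// ltW.
- have := @cross_Rintegral _ _ _ mu A B (fun x => a x `^ p) (fun x => a x ^+ 2)
    (s `^ (p - 2)) (t `^ (p - 2)) mA mB iAp iA2 iBp iB2.
  move=> lt_int eq_int; move: lt_int; rewrite eq_int ltxx => lt_int.
  suff: false by []; apply: lt_int => //.
  + move=> x /= /andP[rx xs]; have ax0 : 0 < a x by lra.
    by rewrite (powR_sqrE p ax0) ler_wpM2r ?sqr_ge0// pow_le// ltW.
  + move=> x /= /andP[tx _]; have ax0 : 0 < a x by lra.
    by rewrite (powR_sqrE p ax0) ler_wpM2r ?sqr_ge0// pow_le// ltW.
  + by rewrite gt0_ltr_powR ?nnegrE// ltW.
Qed.

End Dichotomy.

(** * The exponent infinity *)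

Section Essential.
Context d (T : measurableType d) (R : realType) (mu : probability T R).
Context (k : scalar_kind) (H : completeNormedModType (scalar_field R k)).
Context (dot : {dot H for @sconj R k}).
Hypothesis norm_dot : forall x : H, `|x| ^+ 2 = dot x x.
Context (phi : T -> H) (phi_meas : strongly_measurable phi).
Local Notation a := (fun x => hnorm (phi x)).

Lemma bochner_norm_pinfty_fin (f : T -> H) : bochner_Lp mu +oo%E f ->
  exists2 N : R, bochner_norm mu +oo%E f = N%:E & \forall x \ae mu, hnorm (f x) <= N.
Proof.
move=> [_ fy]; have : bochner_norm mu +oo%E f \is a fin_num.
  by rewrite ge0_fin_numE// Lnorm_ge0.
move=> /fineK fE; exists (fine (bochner_norm mu +oo%E f)) => //.
by apply/bochner_norm_pinfty_le; rewrite fE.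
Qed.

Lemma hilbert_point_pinfty_dichotomy (r s t M : R) :
  hilbert_point mu dot +oo%E phi -> 0 < r -> s < t ->
  mu.-negligible [set x | r <= a x <= s] \/ mu.-negligible [set x | t <= a x <= M].
Proof.
move=> hp r0 st; set A := [set x | _ <= _ <= s].
apply: contrapT => /not_orP[nA nB0].
have [/bochner_norm_pinfty_fin[N NE aN] _ _] := hp.
(* If [N <= s] then [a < t] almost everywhere, and the upper level set would be negligible. *)
have sN : s < N.
  rewrite ltNge; apply/negP => Ns; apply: nB0; apply: negligibleS aN => x /=.
  by move=> /andP[tx _] /(le_trans tx); lra.
(* Only lowering the values near the essential supremum [N] can lower the norm, so [[t, M]] gives
   way to [[t', N]] with [t'] the midpoint of [s] and [N]. *)
pose t' := (s + N) / 2.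
have st' : s < t' by rewrite /t'; lra.
have tN : t' < N by rewrite /t'; lra.
pose B := [set x | t' <= a x <= N].
(* Otherwise [t'] would be an essential bound smaller than [N]. *)
have nB : ~ mu.-negligible B.
  move=> nB; have : (bochner_norm mu +oo%E phi <= t'%:E)%E.
    apply/bochner_norm_pinfty_le.
    have nBC : \forall x \ae mu, ~ B x by apply: negligibleS nB => x /= /contrapT.
    apply: filterS2 nBC aN => x /= nBx xN; rewrite leNgt; apply/negP => tx.
    by apply: nBx; rewrite /B /= xN ltW.
  by rewrite NE lee_fin leNgt tN.
have mA : measurable A by exact: measurable_level.
have mB : measurable B by exact: measurable_level.
have A0 := not_negligible_gt0 mA nA; have B0 := not_negligible_gt0 mB nB.
have [xA /= /andP[rxA xAs]] := measure_gt0_nonempty A0.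
have s0 : 0 < s by lra.
have t'0 : 0 < t' by lra.
have aA x : A x -> a x <= N by move=> /= /andP[_ /le_trans]; apply; exact: ltW.
have aB x : B x -> a x <= N by move=> /= /andP[].
have iA2 := integrable_sqr mu phi_meas mA aA; have iB2 := integrable_sqr mu phi_meas mB aB.
have A2 : 0 < \int[mu]_(x in A) (a x ^+ 2).
  apply: (Rintegral_gt0 mA A0 iA2 (exprn_gt0 2 r0)) => x /= /andP[rx _].
  by rewrite ler_sqr ?nnegrE ?hnorm_ge0// ltW.
have B2 : 0 < \int[mu]_(x in B) (a x ^+ 2).
  apply: (Rintegral_gt0 mB B0 iB2 (exprn_gt0 2 t'0)) => x /= /andP[tx _].
  by rewrite ler_sqr ?nnegrE ?hnorm_ge0// ltW.
set a2 := \int[mu]_(x in A) _ in A2; set b2 := \int[mu]_(x in B) _ in B2.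
have AB0 : A `&` B = set0 by exact: disjoint_levels.
(* The first bound keeps the factor [1 - e * a2] on [B] nonnegative; the second keeps the enlarged
   values on [A] at most [s + (N - s) / 2 = t']. *)
pose e := Num.min a2^-1 ((N - s) / 2 / (b2 * s)).
have e0 : 0 < e.
  by rewrite lt_min invr_gt0 A2 divr_gt0 ?mulr_gt0 ?divr_gt0// subr_gt0.
have ea2 : e * a2 <= 1.
  by rewrite -ler_pdivlMr// mul1r /e ge_min lexx.
have eb2 : e * b2 * s <= (N - s) / 2.
  by rewrite -mulrA -ler_pdivlMr ?mulr_gt0// /e ge_min lexx orbT.
have := @hilbert_point_radial _ _ _ _ _ _ _ norm_dot _ phi_meas +oo%E A B N
  (e * b2) (- (e * a2)) (leey _) hp mA mB AB0 aA aB.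
rewrite -/a2 -/b2 mulNr mulrAC subrr => /(_ erefl).
apply/negP; rewrite -ltNge NE.
apply: (@le_lt_trans _ _ (Num.max t' ((1 - e * a2) * N))%:E); last first.
  rewrite lte_fin gt_max tN /= mulrBl mul1r gtrBl !mulr_gt0//; lra.
apply/bochner_norm_pinfty_le; apply: filterS aN => x xN.
have ax0 := hnorm_ge0 (phi x).
rewrite hnormZ /step; case: ifPn => xA'; case: ifPn => xB; rewrite le_max; apply/orP.
- by have : (A `&` B) x; [split; exact: set_mem|rewrite AB0].
- have /andP[_ xs] : A x by exact: set_mem.
  have eb0 : 0 < e * b2 by exact: mulr_gt0.
  rewrite addr0 ger0_norm; last by rewrite addr_ge0// ltW.
  rewrite mulrDl mul1r.
  have : e * b2 * a x <= e * b2 * s by rewrite ler_wpM2l// ltW.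
  by rewrite /t'; move: (a x) ax0 xs xN => y *; left; lra.
- rewrite add0r ger0_norm ?subr_ge0//; right.
  by rewrite ler_wpM2l// subr_ge0.
(* Points outside [B] with [a <= N] satisfy [a <= t']. *)
- rewrite addr0 addr0 normr1 mul1r; left; rewrite leNgt; apply/negP => tx.
  by move/negP: xB; apply; apply/mem_set; rewrite /B /= xN ltW.
Qed.

Lemma ae_le_Rintegral (f g : T -> R) :
  mu.-integrable setT (EFin \o f) -> mu.-integrable setT (EFin \o g) ->
  (\forall x \ae mu, f x <= g x) -> \int[mu]_x f x <= \int[mu]_x g x.
Proof.
move=> fi gi fg; rewrite -subr_ge0 -RintegralB//.
have /measurable_int/measurable_EFinP mf := fi.
have /measurable_int/measurable_EFinP mg := gi.
have mgf : measurable_fun setT (fun x => g x - f x) by exact: measurable_funB.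
(* Taking the positive part alters the integrand only on a null set and makes it nonnegative
   everywhere. *)
rewrite (_ : Rintegral _ _ _ = \int[mu]_x Num.max (g x - f x) 0).
  by apply: Rintegral_ge0 => x _; rewrite le_max lexx orbT.
rewrite /Rintegral; congr fine; apply: ae_eq_integral => //.
- exact/measurable_EFinP.
- by apply/measurable_EFinP; exact: measurable_maxr.
- by apply: filterS fg => x fgx _; rewrite max_l// subr_ge0.
Qed.

Lemma ae_bounded_integrable (f : T -> R) (K : R) : measurable_fun setT f ->
  (\forall x \ae mu, `|f x| <= K) -> mu.-integrable setT (EFin \o f).
Proof.
move=> mf fK; apply/integrableP; split; first exact/measurable_EFinP.
apply: (@le_lt_trans _ _ (`|K|%:E * mu setT)%E); last first.
  by rewrite probability_setT mule1 ltry.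
apply: integral_le_bound => //; first exact/measurable_EFinP.
apply: filterS fK => x xK _; rewrite /= lee_fin (le_trans xK)//.
exact: ler_norm.
Qed.

Lemma hilbert_point_pinfty_of_two_valued (C : R) (E : set T) :
  ~ (\forall x \ae mu, phi x = 0) ->
  0 < C -> measurable E -> (0 < mu E)%E ->
  (\forall x \ae mu, (E x -> a x = C) /\ (~ E x -> a x = 0)) ->
  hilbert_point mu dot +oo%E phi.
Proof.
move=> phi0 C0 mE E0 aE.
have aC : \forall x \ae mu, a x <= C.
  apply: filterS aE => x [xE xnE].
  by have [/xE ->|/xnE ->] := pselect (E x); [exact: lexx|exact: ltW].
have phiC : (bochner_norm mu +oo%E phi <= C%:E)%E by exact/bochner_norm_pinfty_le.
split=> //.
  by split=> //; exact: le_lt_trans phiC (ltry _).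
move=> f fLp; rewrite /Lp_orthogonal /= => /smk_eq0 orth.
apply: (le_trans phiC); rewrite leNgt; apply/negP => ltC.
have [sf _] := fLp.
have sphif := strongly_measurableD phi_meas sf.
have [K _ fK] := bochner_norm_pinfty_fin fLp.
have [N NE phifN] : exists2 N : R, bochner_norm mu +oo%E (phi \+ f) = N%:E &
    \forall x \ae mu, hnorm (phi x + f x) <= N.
  by apply: bochner_norm_pinfty_fin; split=> //; exact: lt_trans ltC (ltry _).
rewrite NE lte_fin in ltC.
have N0 : 0 <= N by rewrite -lee_fin -NE Lnorm_ge0.
pose g x := sRe (dot (f x) (phi x)).
(* Through norms, [g] is seen to be measurable and essentially bounded, without any measurability of
   [dot]. *)
have gE : g = fun x => (hnorm (phi x + f x) ^+ 2 - hnorm (f x) ^+ 2 - a x ^+ 2) / 2.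
  apply/funext => x; rewrite (addrC (phi x)) (hnormD_sqr norm_dot) /g; lra.
have mg : measurable_fun setT g.
  rewrite gE; apply: measurable_funM => //; apply: measurable_funB.
    apply: measurable_funB; apply: measurable_funX; exact: measurable_hnorm.
  by apply: measurable_funX; exact: measurable_hnorm.
have gi : mu.-integrable setT (EFin \o g).
  apply: (@ae_bounded_integrable _ (N ^+ 2 + K ^+ 2 + C ^+ 2)) => //.
  rewrite gE; apply: filterS3 aC fK phifN => x xC xK xN.
  have sq (u v : R) : 0 <= u -> u <= v -> 0 <= u ^+ 2 <= v ^+ 2.
    by move=> u0 uv; rewrite sqr_ge0 ler_sqr ?nnegrE// (le_trans u0).
  have /andP[? ?] := sq _ _ (hnorm_ge0 _) xC.
  have /andP[? ?] := sq _ _ (hnorm_ge0 _) xK.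
  have /andP[? ?] := sq _ _ (hnorm_ge0 _) xN.
  by rewrite ler_norml; apply/andP; split; lra.
(* By [gE], after dropping the term in [f], almost everywhere on [E] the function [g] is at most
   [- D]. *)
pose D := (C ^+ 2 - N ^+ 2) / 2.
have D0 : 0 < D.
  by rewrite divr_gt0// subr_gt0 ltr_sqr ?nnegrE// ltW.
have hi : mu.-integrable setT (EFin \o (fun x => - D * \1_E x)).
  have iE : mu.-integrable setT (EFin \o (\1_E : T -> R)) by exact: integrable_indic.
  exact: (integrableZl measurableT (- D) iE).
have : \int[mu]_x g x <= \int[mu]_x (- D * \1_E x).
  apply: ae_le_Rintegral => //; apply: filterS2 aE phifN => x [xE xnE] xN.
  rewrite indicE; have [Ex|nEx] := pselect (E x).
    rewrite mem_set// mulr1 gE xE// /D.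
    have := sqr_ge0 (hnorm (f x)).
    have : hnorm (phi x + f x) ^+ 2 <= N ^+ 2.
      by rewrite ler_sqr ?nnegrE ?hnorm_ge0.
    lra.
  rewrite memNset// mulr0 /g (hnorm_eq0 (xnE nEx)) linear0r.
  by rewrite -[X in sRe X](rsc0 R k) sRe_rsc.
rewrite RintegralZl//; last exact: integrable_indic.
(* Orthogonality makes the left side [0], while the right side is [- D] times the positive measure
   of [E]. *)
rewrite /g orth leNgt => /negP; apply.
rewrite mulNr oppr_lt0 mulr_gt0// /Rintegral integral_indic// setIT fine_gt0// E0.
by rewrite (le_lt_trans (probability_le1 _ mE))// ltry.
Qed.

End Essential.

(** * Hilbert points and constant norm on the support *)

Theorem theorem1 (R : realType) (d : measure_display) (T : measurableType d)
    (mu : probability T R) (k : scalar_kind)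
    (H : completeNormedModType (scalar_field R k)) (dot : {dot H for @sconj R k})
    (norm_dot : forall x : H, `|x| ^+ 2 = dot x x)
    (phi : T -> H) (phi_meas : strongly_measurable phi)
    (phi_nontrivial : ~ (\forall w \ae mu, phi w = 0)) :
  (exists p : \bar R, [/\ (1 <= p)%E, p <> 2%:E & hilbert_point mu dot p phi])
  <->
  (exists (C : R) (E : set T), [/\ 0 < C, measurable E, (0 < mu E)%E &
     \forall w \ae mu, (E w -> hnorm (phi w) = C) /\
                       (~ E w -> hnorm (phi w) = 0)]).
Proof.
split=> [[p [p1 p2 hp]]|[C [E [C0 mE E0 phiE]]]]; last first.
  (* A single exponent is asked for, and infinity works for every such [phi]. *)
  exists +oo%E; split=> //; first exact: leey.
  exact: (hilbert_point_pinfty_of_two_valued norm_dot phi_meas phi_nontrivial C0 mE).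
have anz : ~ (\forall w \ae mu, hnorm (phi w) = 0).
  by move=> h; apply: phi_nontrivial; apply: filterS h => w /hnorm_eq0.
have [C C0 aC] : exists2 C, 0 < C &
    \forall w \ae mu, hnorm (phi w) = 0 \/ hnorm (phi w) = C.
  apply: two_valued_ae => //; first exact: measurable_hnorm.
    by move=> w; exact: hnorm_ge0.
  move=> r s t M r0 st; case: p p1 p2 hp => [p p1 p2 hp|_ _ hp|//].
    apply: (hilbert_point_fin_dichotomy norm_dot phi_meas _ _ _ hp) => //.
    by apply/eqP => p2'; apply: p2; rewrite p2'.
  exact: (hilbert_point_pinfty_dichotomy norm_dot phi_meas _ hp).
(* [E] is the set where the norm equals [C], written as a closed range with equal ends so that
   [measurable_level] applies. *)
have mE := measurable_level phi_meas C C.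
exists C, [set w | C <= hnorm (phi w) <= C]; split=> //.
  apply: not_negligible_gt0 => // nE; apply: anz.
  have nEC : \forall w \ae mu, ~ (C <= hnorm (phi w) <= C).
    by apply: negligibleS nE => w /= /contrapT.
  by apply: filterS2 aC nEC => w -[//|->]; rewrite lexx.
apply: filterS aC => w aw; split=> [/= /andP[? ?]|/= nE].
  by apply/eqP; rewrite eq_le; apply/andP.
by case: aw => // awC; case: nE; rewrite awC lexx.
Qed.
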